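(* Let $\omega_N=\{\mathbf{p}_1,\ldots,\mathbf{p}_N\}$ be a set of $N$ independent, uniformly distributed random points on $\mathbb{S}^3$. Then $$ \mathbb{E}\left[E_0(\omega_N)\right]=-\frac{1}{4}N^2+\frac{1}{4}N. $$
   Context: For $\omega_N=\{x_1,\dots,x_N\}\subset\mathbb{S}^3\subset\mathbb{R}^4$, the logarithmic energy is $E_0(\omega_N)=\sum_{i\neq j}\log\frac{1}{\|x_i-x_j\|}$, the sum being over ordered pairs $(i,j)$, $1\le i,j\le N$, $i\ne j$, with $\|\cdot\|$ the Euclidean norm. ''Uniformly distributed'' means distributed according to normalized surface measure. *)

(* Defs.v *)
From HB Require Import structures.
From mathcomp Require Import all_boot all_order all_algebra.
From mathcomp Require Import all_classical all_reals all_analysis.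

Set Implicit Arguments.
Unset Strict Implicit.
Unset Printing Implicit Defensive.

Import Order.TTheory GRing.Theory Num.Theory.

Local Open Scope classical_set_scope.
Local Open Scope ring_scope.

(* Euclidean 4-space is [4.-tuple R], which carries the product Borel
   sigma-algebra (generated by the four coordinate maps). *)

Definition enorm (R : realType) (n : nat) (x : n.-tuple R) : R :=
  Num.sqrt (\sum_(i < n) tnth x i ^+ 2).

Definition edist (R : realType) (n : nat) (x y : n.-tuple R) : R :=
  enorm [tuple tnth x i - tnth y i | i < n].

Definition sphere3 (R : realType) : set (4.-tuple R) := [set x | enorm x = 1].

Definition tuple4_of_pair (R : realType) (z : R * R * R * R) : 4.-tuple R :=
  [tuple z.1.1.1; z.1.1.2; z.1.2; z.2].

Definition lebesgue4 (R : realType) : set (4.-tuple R) -> \bar R :=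
  pushforward
    (((@lebesgue_measure R \x @lebesgue_measure R) \x @lebesgue_measure R)
       \x @lebesgue_measure R)%E
    (@tuple4_of_pair R).

(* The truncated cone {t y : 0 < t <= 1, y in A}. *)
Definition unit_cone (R : realType) (A : set (4.-tuple R)) : set (4.-tuple R) :=
  [set x | exists t : R, exists2 y, A y &
     0 < t <= 1 /\ x = [tuple t * tnth y i | i < 4]].

(* Surface measure on the unit sphere of R^n, in its usual measure-theoretic
   definition via polar coordinates: sigma(A) = n * Leb {t y : 0 < t <= 1, y in A},
   here with n = 4.  It is viewed as a Borel measure on R^4 carried by the
   sphere. *)
Definition surface_measure (R : realType) (A : set (4.-tuple R)) : \bar R :=
  (4%:R%:E * lebesgue4 (unit_cone (A `&` @sphere3 R)))%E.

Definition normalized_surface_measure (R : realType) (A : set (4.-tuple R)) :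
    \bar R :=
  (surface_measure A / surface_measure (@sphere3 R))%E.

Definition uniform_on_sphere3 (d : measure_display) (T : measurableType d)
    (R : realType) (P : probability T R) (X : {RV P >-> 4.-tuple R}) : Prop :=
  (forall w, sphere3 (X w)) /\
  forall A, measurable A -> distribution P X A = normalized_surface_measure A.

Definition mutually_independent (d d' : measure_display)
    (T : measurableType d) (T' : measurableType d') (R : realType)
    (P : probability T R) (I : finType) (X : I -> {RV P >-> T'}) : Prop :=
  forall (J : {set I}) (A : I -> set T'), (forall i, measurable (A i)) ->
    P (\bigcap_(i in [set` J]) (X i @^-1` A i)) =
    (\prod_(i in J) P (X i @^-1` A i))%E.

(* Sum over ordered pairs (i, j) with i <> j.  For coinciding points the
   summand log (1 / 0) takes the library value [ln 0 = 0]; for independent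
   uniform points this happens with probability zero. *)
Definition log_energy (R : realType) (N : nat) (x : 'I_N -> 4.-tuple R) : R :=
  \sum_(i < N) \sum_(j < N | i != j) ln (1 / edist (x i) (x j)).

(* Main.v *)
(* By linearity and independence the energy is [N (N - 1)] times the mean of
   [log (1 / |x - y|)] with [x] fixed and [y] uniform on the sphere.  A uniform point is the
   radial projection of a uniform point of the unit ball, and Lebesgue measure on R^4
   is invariant under rotations of two coordinates (products of shears and
   dilations), so [x] may be moved to the last axis.  Writing the last coordinate of a
   point [(v, t)] of the ball as [t = |v| s] and rescaling [v] reduces the mean to
   [\int G(s / sqrt(1 + s^2)) (1 + s^2)^-2 ds / \int (1 + s^2)^-2 ds] with
   [G t = - log (2 - 2 t) / 2].  Symmetrizing in [s] leaves
   [\int log(1 + s^2) (1 + s^2)^-2 ds = pi log 2 - pi / 2], obtained by writing the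
   logarithm as [\int_0^1 2 a s^2 / (1 + a^2 s^2) da] and integrating in [s] first. *)
From HB Require Import structures.
Require Import Defs.
From mathcomp Require Import all_boot all_order all_algebra.
From mathcomp Require Import all_classical all_reals all_analysis.
From mathcomp Require Import measurable_realfun ring lra.

Import Order.TTheory GRing.Theory Num.Theory.
Import numFieldNormedType.Exports.
Local Open Scope classical_set_scope.
Local Open Scope ring_scope.

Set Implicit Arguments.
Unset Strict Implicit.
Unset Printing Implicit Defensive.

(** * Maps rescaling a measure *)

(* The library's sigma-finite structure on [m1 \x m2] is shadowed by the one for
   products of subprobabilities, hence this explicit packing. *)
Section sigma_finite_product.
Local Open Scope ereal_scope.
Context d1 d2 (T1 : measurableType d1) (T2 : measurableType d2) (R : realType).
Variable m1 : {sigma_finite_measure set T1 -> \bar R}.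
Variable m2 : {sigma_finite_measure set T2 -> \bar R}.

Lemma product_measure1_sigma_finite : sigma_finite setT (m1 \x m2).
Proof.
have /sigma_finiteP[F [TF ndF Ffin]] := sigma_finiteT m1.
have /sigma_finiteP[G [TG ndG Gfin]] := sigma_finiteT m2.
exists (fun n => F n `*` G n).
  apply/esym/seteqP; split=> // -[x y] _.
  have [/= i _ Fx] : (\bigcup_n F n) x by rewrite -TF.
  have [/= j _ Gy] : (\bigcup_n G n) y by rewrite -TG.
  exists (i + j)%N => //; split=> /=.
  - exact: (subsetPset _ _ (ndF _ _ (leq_addr j i))) x Fx.
  - exact: (subsetPset _ _ (ndG _ _ (leq_addl i j))) y Gy.
move=> n; have [mF Foo] := Ffin n; have [mG Goo] := Gfin n.
split; first exact: measurableX.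
by rewrite product_measure1E// lte_mul_pinfty// ge0_fin_numE.
Qed.

Definition sfprod : {sigma_finite_measure set (T1 * T2)%type -> \bar R} :=
  HB.pack_for {sigma_finite_measure set (T1 * T2)%type -> \bar R} (m1 \x m2)
    (Measure_isSigmaFinite.Build _ _ _ (m1 \x m2) product_measure1_sigma_finite).

Lemma sfprodE : sfprod = m1 \x m2 :> (set (T1 * T2) -> \bar R).
Proof. by []. Qed.

Lemma integral_sfprod1 (f : T1 * T2 -> \bar R) :
  measurable_fun setT f -> (forall z, 0 <= f z) ->
  \int[sfprod]_z f z = \int[m1]_x \int[m2]_y f (x, y).
Proof. exact: fubini_tonelli1. Qed.

End sigma_finite_product.

Section scaling_maps.
Context {R : realType}.
Local Open Scope ereal_scope.

(** The pushforward of [m] by [phi] is [k] times [m]; for a linear map [k] is the inverse of the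
    absolute determinant. Testing against nonnegative functions makes the property stable under
    composition and, by Tonelli, under products. *)
Definition scales d (T : measurableType d) (m : set T -> \bar R) (k : R)
    (phi : T -> T) : Prop :=
  measurable_fun setT phi /\
  forall f : T -> \bar R, measurable_fun setT f -> (forall x, 0 <= f x) ->
    \int[m]_x f (phi x) = k%:E * \int[m]_x f x.

Lemma scales_id d (T : measurableType d) (m : {measure set T -> \bar R}) :
  scales m 1 id.
Proof. by split=> [|f _ _]; [exact: measurable_id|rewrite mul1e]. Qed.

Lemma scales_comp d (T : measurableType d) (m : {measure set T -> \bar R})
    k l phi psi :
  scales m k phi -> scales m l psi -> scales m (k * l)%R (phi \o psi).
Proof.
move=> [mphi iphi] [mpsi ipsi]; split; first exact: measurableT_comp.
move=> f mf f0; rewrite (ipsi (fun x => f (phi x)))//; last first.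
  exact: (measurableT_comp mf mphi).
by rewrite iphi// muleA -EFinM mulrC.
Qed.

Lemma scales_prod d1 d2 (T1 : measurableType d1) (T2 : measurableType d2)
    (m1 : {sigma_finite_measure set T1 -> \bar R})
    (m2 : {sigma_finite_measure set T2 -> \bar R}) k l phi psi :
  (0 <= k)%R -> (0 <= l)%R ->
  scales m1 k phi -> scales m2 l psi ->
  scales (sfprod m1 m2) (k * l)%R (fun z => (phi z.1, psi z.2)).
Proof.
move=> k0 l0 [mphi iphi] [mpsi ipsi].
have mpp : measurable_fun setT (fun z : T1 * T2 => (phi z.1, psi z.2)).
  by apply: measurable_fun_pair; exact: measurableT_comp.
split=> // f mf f0.
have mff : measurable_fun setT (fun z : T1 * T2 => f (phi z.1, psi z.2)).
  exact: (measurableT_comp mf).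
rewrite (@integral_sfprod1 _ _ _ _ _ _ _ (fun z => f (phi z.1, psi z.2)))//=.
under eq_integral => x _.
  rewrite (ipsi (fun y => f (phi x, y)))//; last exact: measurableT_comp.
  over.
have mF := measurable_fun_fubini_tonelli_F (m2 := m2) f mf f0.
have F0 x : 0 <= fubini_F m2 f x by apply: integral_ge0.
rewrite (iphi (fun x => l%:E * fubini_F m2 f x)); last 2 first.
- exact: measurable_funeM.
- by move=> x; rewrite mule_ge0.
rewrite ge0_integralZl//.
by rewrite integral_sfprod1// muleA -EFinM.
Qed.

Lemma integral_sfprod3 d1 d2 d3 (T1 : measurableType d1)
    (T2 : measurableType d2) (T3 : measurableType d3)
    (m1 : {sigma_finite_measure set T1 -> \bar R})
    (m2 : {sigma_finite_measure set T2 -> \bar R})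
    (m3 : {sigma_finite_measure set T3 -> \bar R}) (f : T1 * T2 * T3 -> \bar R) :
  measurable_fun setT f -> (forall z, 0 <= f z) ->
  \int[sfprod (sfprod m1 m2) m3]_z f z =
  \int[m1]_x \int[m2]_y \int[m3]_z f (x, y, z).
Proof.
move=> mf f0.
rewrite (integral_sfprod1 _ _ mf f0).
apply: (integral_sfprod1 m1 m2 (f := fubini_F m3 f)).
- exact: (measurable_fun_fubini_tonelli_F f mf f0).
- by move=> x; apply: integral_ge0 => y _; exact: f0.
Qed.

(** Tonelli in the last two variables with the first one frozen. Such swaps let a rotation of the
    first two coordinates of R^4 act on any pair of them. *)
Lemma scales_swap23 d1 d2 (T1 : measurableType d1) (T2 : measurableType d2)
    (m1 : {sigma_finite_measure set T1 -> \bar R})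
    (m2 : {sigma_finite_measure set T2 -> \bar R}) :
  scales (sfprod (sfprod m1 m2) m2) 1 (fun z => ((z.1.1, z.2), z.1.2)).
Proof.
have mpp : measurable_fun setT
    (fun z : T1 * T2 * T2 => ((z.1.1, z.2), z.1.2)).
  apply: measurable_fun_pair; last exact: measurableT_comp.
  by apply: measurable_fun_pair => //; exact: measurableT_comp.
split=> // f mf f0; rewrite mul1e.
have mff : measurable_fun setT (fun z : T1 * T2 * T2 => f (z.1.1, z.2, z.1.2)).
  exact: (measurableT_comp mf mpp).
apply: (etrans (integral_sfprod3 m1 m2 m2 mff (fun=> f0 _))).
apply/esym; apply: (etrans (integral_sfprod3 m1 m2 m2 mf f0)).
apply: eq_integral => x _ /=.
apply: (fubini_tonelli (m1 := m2) (m2 := m2) (fun y => f (x, y.1, y.2))).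
- apply: (measurableT_comp mf) => /=.
  apply: measurable_fun_pair => //.
  by apply: measurable_fun_pair => //; exact: measurableT_comp.
- by move=> y; exact: f0.
Qed.

(** Lebesgue measure is the only measure giving half-open intervals their length, and [a] times the
    pushforward by multiplication by [a] does so. *)
Lemma scales_mul_pos (a : R) : (0 < a)%R ->
  scales (@lebesgue_measure R) a^-1 ( *%R a).
Proof.
move=> a0; have ma : measurable_fun setT ( *%R a : R -> R) by [].
split=> // f mf f0.
pose k : {nonneg R} := NngNum (ltW a0).
have E A : measurable A ->
    lebesgue_measure A = mscale k
      (pushforward (@lebesgue_measure R) ( *%R a : R -> measurableTypeR R)) A.
  apply: lebesgue_measure_unique => _ [[u v] _ <-].
  rewrite -[RHS]/(a%:E * lebesgue_measure (( *%R a : R -> R) @^-1` `]u, v])).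
  rewrite (_ : _ @^-1` _ = `]u / a, v / a]%classic)%R; last first.
    apply/seteqP; split=> x /=; rewrite !in_itv/= => /andP[xu xv]; apply/andP;
      split.
    - by rewrite ltr_pdivrMr// mulrC.
    - by rewrite ler_pdivlMr// mulrC.
    - by move: xu; rewrite ltr_pdivrMr// mulrC.
    - by move: xv; rewrite ler_pdivlMr// mulrC.
  rewrite !lebesgue_measure_itv/= !lte_fin ltr_pM2r ?invr_gt0//.
  case: ifPn => _; last by rewrite mule0.
  by rewrite -EFinD -EFinM; congr EFin; field; rewrite gt_eqF.
rewrite [in RHS](eq_measure_integral (mscale k
      (pushforward (@lebesgue_measure R) ( *%R a : R -> measurableTypeR R)))); last first.
  by move=> A mA _; exact: E.
rewrite ge0_integral_mscale// ge0_integral_pushforward//= muleA -EFinM.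
by rewrite mulVf ?gt_eqF// mul1e preimage_setT.
Qed.

Lemma scales_opp : scales (@lebesgue_measure R) 1 -%R.
Proof.
have mN : measurable_fun setT (-%R : R -> R) by exact: oppr_measurable.
split=> // f mf f0; rewrite mul1e.
have := ge0_integral_pushforward
  (phi := -%R : measurableTypeR R -> measurableTypeR R) mN
  (@lebesgue_measure R) measurableT mf (fun y _ => f0 y).
rewrite preimage_setT => <-.
apply: eq_measure_integral => A mA _; exact: lebesgue_measureN.
Qed.

Lemma scales_shift (b : R) : scales (@lebesgue_measure R) 1 (+%R b).
Proof.
have ma : measurable_fun setT (+%R b : R -> R) by exact: measurable_funD.
split=> // f mf f0; rewrite mul1e.
have := ge0_integral_pushforward
  (phi := +%R b : measurableTypeR R -> measurableTypeR R) ma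
  (@lebesgue_measure R) measurableT mf (fun y _ => f0 y).
rewrite preimage_setT => <-.
apply: eq_measure_integral => A mA _; apply/esym.
apply: lebesgue_measure_unique mA => _ [[u v] _ <-].
rewrite -[RHS]/(lebesgue_measure ((+%R b : R -> R) @^-1` `]u, v])).
rewrite (_ : _ @^-1` _ = `]u - b, v - b]%classic)%R; last first.
  apply/seteqP; split=> x /=; rewrite !in_itv/= => /andP[xu xv]; apply/andP;
    split; lra.
rewrite !lebesgue_measure_itv/= !lte_fin ltrD2r.
by case: ifPn => _ //; rewrite -!EFinD; congr EFin; ring.
Qed.

Lemma scales_affine (a b : R) : a != 0%R ->
  scales (@lebesgue_measure R) `|a|^-1 (fun x => a * x + b)%R.
Proof.
move=> a0.
have -> : (fun x => a * x + b)%R = (+%R b) \o ( *%R a).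
  by apply/funext => x /=; rewrite addrC.
rewrite -[(`|a|^-1)%R]mul1r; apply: scales_comp (scales_shift b) _.
have [a_gt0|a_lt0|/esym/eqP] := ltgtP 0%R a; last by rewrite (negbTE a0).
  by rewrite gtr0_norm//; exact: scales_mul_pos.
have -> : ( *%R a) = -%R \o ( *%R (- a)) :> (R -> R).
  by apply/funext => x /=; rewrite mulNr opprK.
rewrite ltr0_norm// -[((- a)^-1)%R]mul1r.
by apply: scales_comp scales_opp _; apply: scales_mul_pos; rewrite oppr_gt0.
Qed.

End scaling_maps.

(** * Invariance of planar Lebesgue measure under rotations *)

Section rotations.
Context {R : realType}.
Local Notation mu := (@lebesgue_measure R).

(** For [c != 0], put [w = c u - s v] at fixed [v], at the cost of [|c|^-1]. Since [c^2 + s^2 = 1],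
    the second coordinate becomes [(s w + v) / c], and rescaling [v] at fixed [w] gives [|c|] back.
    For [c = 0] one has [s = 1] or [s = -1], and the map is a swap with sign changes. *)
Lemma scales_rotation (c s : R) : c ^+ 2 + s ^+ 2 = 1 ->
  scales (sfprod mu mu) 1 (fun z => (c * z.1 - s * z.2, s * z.1 + c * z.2)).
Proof.
move=> cs1.
have mrot : measurable_fun setT
    (fun z : R * R => (c * z.1 - s * z.2, s * z.1 + c * z.2)).
  by apply: measurable_fun_pair; [apply: measurable_funB|apply: measurable_funD];
    apply: measurable_funM.
split=> // f mf f0; rewrite mul1e.
have mfrot := measurableT_comp mf mrot.
apply: (etrans (integral_sfprod1 mu mu mfrot (fun=> f0 _))).
apply/esym; apply: (etrans (integral_sfprod1 mu mu mf f0)); apply/esym.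
have [c0|c0] := eqVneq c 0.
  have s_unit : `|s| = 1.
    apply/eqP; rewrite -sqr_norm_eq1.
    by move: cs1; rewrite c0 expr0n add0r => ->.
  have s0 : s != 0 by rewrite -normr_eq0 s_unit oner_neq0.
  have [_ aff] := scales_affine 0 s0.
  have [_ affN] : scales mu `|- s|^-1 (fun x => - s * x + 0).
    by apply: scales_affine; rewrite oppr_eq0.
  pose h (u v : R) := f (v, s * u + 0).
  transitivity (\int[mu]_u \int[mu]_v h u v)%E.
    apply: eq_integral => u _.
    have mg : measurable_fun setT (h u).
      exact: (measurableT_comp mf (pair2_measurable _)).
    rewrite -[RHS]mul1e -invr1 -s_unit -normrN -(affN _ mg (fun=> f0 _)).
    by apply: eq_integral => v _; congr f; congr pair; rewrite c0 /=; ring.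
  have mG := measurable_fun_fubini_tonelli_G (m1 := mu) f mf f0.
  rewrite (aff _ mG); last by move=> x; apply: integral_ge0.
  rewrite s_unit invr1 mul1e.
  exact/esym/(fubini_tonelli (m1 := mu) (m2 := mu) f mf f0).
have ac0 : 0 <= `|c|^-1 by rewrite invr_ge0.
have key (u v : R) : s * u + c * v = (s * (c * u - s * v) + v) / c.
  apply: (mulIf c0); rewrite mulfVK//.
  have -> : (s * (c * u - s * v) + v) =
    s * (c * u - s * v) + (c ^+ 2 + s ^+ 2) * v by rewrite cs1 mul1r.
  by ring.
have affc v := (scales_affine (- (s * v)) c0).2.
have ic0 : c^-1 != 0 by rewrite invr_eq0.
have affi v := (scales_affine (s * v / c) ic0).2.
have /= fub := fubini_tonelli (m1 := mu) (m2 := mu) _ mfrot (fun=> f0 _).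
apply: (etrans fub) => {fub}.
pose h (z : R * R) := f (z.1, (s * z.1 + z.2) / c).
have mh : measurable_fun setT h.
  apply: (measurableT_comp mf); apply: measurable_fun_pair => //.
  by apply: measurable_funM => //; apply: measurable_funD => //;
    apply: measurable_funM.
transitivity (\int[mu]_v (`|c|^-1%:E *
    \int[mu]_w h (w, v)))%E.
  apply: eq_integral => v _.
  have mhv : measurable_fun setT (fun w => h (w, v)).
    exact: (measurableT_comp mh (pair2_measurable _)).
  rewrite -(affc v _ mhv (fun=> f0 _)).
  by apply: eq_integral => u _; rewrite /h /= -key.
have mhG := measurable_fun_fubini_tonelli_G (m1 := mu) _ mh (fun=> f0 _).
rewrite ge0_integralZl//; last first.
  by move=> x _; apply: integral_ge0 => y _; exact: f0.
rewrite -(fubini_tonelli (m1 := mu) (m2 := mu) _ mh (fun=> f0 _)) /=.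
have mF := measurable_fun_fubini_tonelli_F (m2 := mu) f mf f0.
rewrite (eq_integral (fun w => `|c|%:E * \int[mu]_v f (w, v))%E).
  rewrite ge0_integralZl//; last by move=> x _; apply: integral_ge0.
  by rewrite muleA -EFinM mulVf ?mul1e// normr_eq0.
move=> w _.
have mfw : measurable_fun setT (fun v => f (w, v)).
  exact: (measurableT_comp mf (pair1_measurable _)).
rewrite -[`|c|]invrK -normfV -(affi w _ mfw (fun=> f0 _)).
by apply: eq_integral => v _; congr f; congr pair; rewrite /=; field.
Qed.

End rotations.

(** * Rotations of R^4 *)

Section isotropy.
Context {R : realType}.
Local Notation mu := (@lebesgue_measure R).

Definition leb3 := sfprod (sfprod mu mu) mu.
Definition leb4 := sfprod leb3 mu.

Definition dot4 (x z : R * R * R * R) : R :=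
  x.1.1.1 * z.1.1.1 + x.1.1.2 * z.1.1.2 + x.1.2 * z.1.2 + x.2 * z.2.

(* Invariance of Lebesgue measure under an isometry moving [x] to the last axis. *)
Definition isotropic (x : R * R * R * R) :=
  exists phi : R * R * R * R -> R * R * R * R,
  scales leb4 1 phi /\
  forall z, dot4 x (phi z) = z.2 /\ dot4 (phi z) (phi z) = dot4 z z.

(** The isometry for [x] is [psi] after the one for [y]. This lets [x] be carried to the last axis
    by elementary moves. *)
Lemma isotropic_step psi x y : scales leb4 1 psi ->
  (forall z, dot4 x (psi z) = dot4 y z) ->
  (forall z, dot4 (psi z) (psi z) = dot4 z z) -> isotropic y -> isotropic x.
Proof.
move=> spsi xy psipsi [phi [sphi yphi]]; exists (psi \o phi); split.
  by rewrite -[1]mulr1; exact: scales_comp.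
by move=> z; rewrite /= xy psipsi.
Qed.

Lemma isotropic_swap34 (a b c d : R) :
  isotropic (a, b, d, c) -> isotropic (a, b, c, d).
Proof.
apply: (@isotropic_step (fun z => (z.1.1, z.2, z.1.2))).
- exact: scales_swap23.
- by move=> [[[p q] r] s]; rewrite /dot4 /=; ring.
- by move=> [[[p q] r] s]; rewrite /dot4 /=; ring.
Qed.

Lemma isotropic_swap23 (a b c d : R) :
  isotropic (a, c, b, d) -> isotropic (a, b, c, d).
Proof.
apply: (@isotropic_step (fun z => ((z.1.1.1, z.1.2, z.1.1.2), z.2))).
- rewrite -[1]mulr1.
  apply: (scales_prod (phi := fun z => (z.1.1, z.2, z.1.2))
    _ _ _ (scales_id _)) => //.
  exact: scales_swap23.
- by move=> [[[p q] r] s]; rewrite /dot4 /=; ring.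
- by move=> [[[p q] r] s]; rewrite /dot4 /=; ring.
Qed.

Lemma isotropic_rot12 (co si a b c d : R) : co ^+ 2 + si ^+ 2 = 1 ->
  isotropic (co * a + si * b, co * b - si * a, c, d) -> isotropic (a, b, c, d).
Proof.
move=> cs1.
pose rot (z : R * R) := (co * z.1 - si * z.2, si * z.1 + co * z.2).
apply: (@isotropic_step (fun z => ((rot z.1.1, z.1.2), z.2))).
- rewrite -[1]mulr1.
  apply: (scales_prod (m1 := leb3) (m2 := mu) (phi := fun z => (rot z.1, z.2))
    _ _ _ (scales_id _)) => //.
  rewrite -[1]mulr1.
  apply: (scales_prod (m1 := sfprod mu mu) (m2 := mu) (phi := rot)
    _ _ _ (scales_id _)) => //.
  exact: scales_rotation.
- by move=> [[[p q] u] v]; rewrite /dot4 /rot /=; ring.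
- move=> [[[p q] u] v]; rewrite /dot4 /rot /=.
  rewrite -[in RHS](mul1r (p * p)) -[in RHS](mul1r (q * q)) -cs1; ring.
Qed.

(** A Givens rotation with cosine [a / r] and sine [b / r] clears the second coordinate. If [r = 0],
    then [a] and [b] vanish already. *)
Lemma isotropic_norm12 (a b c d : R) :
  isotropic (Num.sqrt (a ^+ 2 + b ^+ 2), 0, c, d) -> isotropic (a, b, c, d).
Proof.
set r := Num.sqrt _ => iso.
have r2 : r ^+ 2 = a ^+ 2 + b ^+ 2 by rewrite sqr_sqrtr// addr_ge0 ?sqr_ge0.
have [r0|r0] := eqVneq r 0.
  move: r2 iso; rewrite r0 expr0n/= => /esym/eqP.
  by rewrite paddr_eq0 ?sqr_ge0// !sqrf_eq0 => /andP[/eqP -> /eqP ->].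
apply: (@isotropic_rot12 (a / r) (b / r)).
  by rewrite !expr_div_n -mulrDl -r2 mulfV// sqrf_eq0.
rewrite (_ : a / r * a + _ = r); last first.
  by apply: (mulIf r0); rewrite -expr2 r2; field.
by rewrite (_ : a / r * b - _ = 0)//; field.
Qed.

Lemma isotropicP (a b c d : R) :
  a ^+ 2 + b ^+ 2 + c ^+ 2 + d ^+ 2 = 1 -> isotropic (a, b, c, d).
Proof.
move=> abcd1.
apply: isotropic_norm12; apply: isotropic_swap23.
apply: isotropic_norm12; apply: isotropic_swap34; apply: isotropic_swap23.
apply: isotropic_norm12.
rewrite !sqr_sqrtr ?addr_ge0 ?sqr_ge0// abcd1 sqrtr1.
(* The vector is now the first basis vector; a quarter turn puts it on the second axis, and two
   swaps on the last. *)
apply: (@isotropic_rot12 0 (-1)); first by rewrite expr0n/= add0r sqrrN expr1n.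
apply: isotropic_swap23; apply: isotropic_swap34.
exists id; split; first exact: scales_id.
by move=> [[[p q] u] v]; rewrite /dot4 /=; split=> //; ring.
Qed.

End isotropy.

(** * Reduction to one variable *)

Section polar.
Context {R : realType}.
Local Notation mu := (@lebesgue_measure R).

Lemma measurable_sqrtr d (T : measurableType d) (f : T -> R) :
  measurable_fun setT f -> measurable_fun setT (fun x => Num.sqrt (f x)).
Proof.
move=> mf; apply: (@measurableT_comp _ _ _ _ _ _ (@Num.sqrt R)) => //.
by apply: nondecreasing_measurable => // x y; exact: ler_wsqrtr.
Qed.

Lemma measurable_sqrtrV d (T : measurableType d) (f : T -> R) :
  measurable_fun setT f -> measurable_fun setT (fun x => (Num.sqrt (f x))^-1).
Proof.
move=> mf; under eq_fun do rewrite -powR_inv1 ?sqrtr_ge0//.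
apply: (@measurableT_comp _ _ _ _ _ _ (@powR R ^~ (-1))).
  exact: measurable_powR.
exact: measurable_sqrtr.
Qed.

Definition normsq3 (v : R * R * R) : R := v.1.1 ^+ 2 + v.1.2 ^+ 2 + v.2 ^+ 2.

Lemma normsq3_ge0 v : 0 <= normsq3 v.
Proof. by rewrite /normsq3 !addr_ge0 ?sqr_ge0. Qed.

Lemma measurable_normsq3 : measurable_fun setT normsq3.
Proof.
by apply: measurable_funD; [apply: measurable_funD|];
  apply: measurable_funX => //; apply: measurableT_comp.
Qed.

(** The substitution [t = |v| s] breaks down only at [v = 0]; this makes the exception
    negligible. *)
Lemma normsq3_null : (@leb3 R) [set v | normsq3 v = 0] = 0%E.
Proof.
have -> : [set v | normsq3 v = 0] = [set 0] `*` [set 0] `*` [set 0].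
  apply/seteqP; split=> [[[a b] c] /= /eqP|[[a b] c] /= [[-> ->] ->]].
    rewrite /normsq3 /= paddr_eq0 ?addr_ge0 ?sqr_ge0//.
    rewrite paddr_eq0 ?sqr_ge0// !sqrf_eq0.
    by move=> /andP[/andP[/eqP -> /eqP ->] /eqP ->].
  by rewrite /normsq3 /= expr0n /= !addr0.
have m1 : measurable ([set 0] : set (measurableTypeR R)).
  exact: lebesgue_stieltjes_measure.measurable_set1.
rewrite /leb3 sfprodE (product_measure1E (sfprod mu mu) mu (measurableX m1 m1) m1).
apply: (etrans (congr1 (fun x => sfprod mu mu _ * x)%E
  (lebesgue_measure_set1 0))).
by rewrite mule0.
Qed.

Lemma measurable_weight d (T : measurableType d) (f : T -> R) :
  measurable_fun setT f -> measurable_fun setT (fun x => (1 + f x ^+ 2) ^- 2).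
Proof.
move=> mf.
(* As a fourth power of an inverse square root, the weight falls under [measurable_sqrtrV]. *)
rewrite (_ : (fun _ => _) = (fun x => (Num.sqrt (1 + f x ^+ 2))^-1 ^+ 4)).
  apply: measurable_funX.
  apply: measurable_sqrtrV; apply: measurable_funD => //.
  exact: measurable_funX.
apply/funext => s; rewrite exprVn; congr (_^-1).
by rewrite -[in LHS](@sqr_sqrtr _ (1 + f s ^+ 2)) ?addr_ge0 ?sqr_ge0// -exprM.
Qed.

Lemma scales_homothety (l : R) : 0 < l ->
  scales leb3 (l^-1 * l^-1 * l^-1) (fun v => (l * v.1.1, l * v.1.2, l * v.2)).
Proof.
move=> l0; have lV : 0 <= l^-1 by rewrite invr_ge0 ltW.
apply: (scales_prod (m1 := sfprod mu mu) (m2 := mu)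
  (phi := fun v => (l * v.1, l * v.2)) (psi := *%R l)) => //.
- by rewrite mulr_ge0.
- apply: (scales_prod (m1 := mu) (m2 := mu) (phi := *%R l) (psi := *%R l)) => //;
    exact: scales_mul_pos.
- exact: scales_mul_pos.
Qed.

(* Indicator of the punctured unit ball, as a function of the squared norm. *)
Definition ball_indic : R -> R := \1_(`]0, 1]%classic).

Lemma measurable_ball_indic : measurable_fun setT ball_indic.
Proof. exact: measurable_indic. Qed.

Lemma ball_indic_ge0 r : 0 <= ball_indic r.
Proof. by rewrite /ball_indic indicE. Qed.

Lemma ball_indicE r : ball_indic r = ((0 < r) && (r <= 1))%:R.
Proof. by rewrite /ball_indic indicE mem_setE in_itv. Qed.

(* The profile [G] of a function of the polar angle from the last axis, extended
   to the punctured unit ball as a function of [q = z_4] and [r = |z|^2]. *)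
Definition zonal (G : R -> R) (q r : R) : R :=
  ball_indic r * G (q / Num.sqrt r).

(** A constant common to all profiles [G]. Its value is never computed: the total mass of a
    probability law fixes the constant that contains it. *)
Definition radial_mass : \bar R :=
  (\int[leb3]_v (Num.sqrt (normsq3 v) *
     ball_indic (normsq3 v))%:E)%E.

Lemma radial_mass_ge0 : (0 <= radial_mass)%E.
Proof.
by apply: integral_ge0 => v _; rewrite lee_fin mulr_ge0 ?sqrtr_ge0 ?ball_indic_ge0.
Qed.

Lemma measurable_zonal d (T : measurableType d) (G : R -> R) (f g : T -> R) :
  measurable_fun setT G -> measurable_fun setT f -> measurable_fun setT g ->
  measurable_fun setT (fun x => zonal G (f x) (g x)).
Proof.
move=> mG mf mg; apply: measurable_funM.
  apply: (measurableT_comp measurable_ball_indic) => //.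
apply: (measurableT_comp mG); apply: measurable_funM => //.
exact: measurable_sqrtrV.
Qed.

Lemma zonal_ge0 G q r : (forall t, 0 <= G t) -> 0 <= zonal G q r.
Proof. by move=> G0; rewrite /zonal mulr_ge0// indicE. Qed.

(** For fixed [v], the substitution [t = |v| s] has Jacobian [|v|] and turns [|z|^2] into
    [|v|^2 (1 + s^2)], so the angle depends on [s] alone. For fixed [s], with [l = sqrt (1 + s^2)],
    rescaling [v] by [l] in dimension 3 gives [l^-3] and the factor [|v|] gives [l^-1], hence the
    weight [(1 + s^2)^-2]. *)
Lemma integral_zonal (G : R -> R) :
  measurable_fun setT G -> (forall t, 0 <= G t) ->
  (\int[leb4]_z (zonal G z.2 (dot4 z z))%:E =
   radial_mass *
   \int[mu]_s (G (s / Num.sqrt (1 + s ^+ 2)) * (1 + s ^+ 2) ^- 2)%:E)%E.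
Proof.
move=> mG G0.
pose f (z : R * R * R * R) := (zonal G z.2 (normsq3 z.1 + z.2 ^+ 2))%:E.
have mf : measurable_fun setT f.
  apply/measurable_EFinP; apply: measurable_zonal => //.
  apply: measurable_funD; last exact: measurable_funX.
  exact: (measurableT_comp measurable_normsq3).
have f0 z : (0 <= f z)%E by rewrite lee_fin zonal_ge0.
transitivity (\int[leb4]_z f z)%E.
  by apply: eq_integral => -[[[a b] c] d] _; rewrite /f /dot4 /normsq3 /= -!expr2.
pose h (v : R * R * R) (l : R) : R := Num.sqrt (normsq3 v) *
     ball_indic (l * normsq3 v).
(* The integrand after [t = |v| s], with the Jacobian [|v|] stored in [h]. *)
pose k (z : R * R * R * R) : \bar R := (h z.1 (1 + z.2 ^+ 2) *
   G (z.2 / Num.sqrt (1 + z.2 ^+ 2)))%:E.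
have mh d (T : measurableType d) (f1 : T -> R * R * R) (f2 : T -> R) :
    measurable_fun setT f1 -> measurable_fun setT f2 ->
    measurable_fun setT (fun x => h (f1 x) (f2 x)).
  move=> mf1 mf2; have m1 := measurableT_comp measurable_normsq3 mf1.
  apply: measurable_funM; first exact: measurable_sqrtr.
  apply: (measurableT_comp measurable_ball_indic).
  exact: measurable_funM.
have h0 v l : 0 <= h v l by rewrite mulr_ge0 ?sqrtr_ge0 ?ball_indic_ge0.
have mG' d (T : measurableType d) (f2 : T -> R) : measurable_fun setT f2 ->
    measurable_fun setT (fun x => G (f2 x / Num.sqrt (1 + f2 x ^+ 2))).
  move=> mf2; apply: (measurableT_comp mG); apply: measurable_funM => //.
  apply: measurable_sqrtrV; apply: measurable_funD => //.
  exact: measurable_funX.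
have mk : measurable_fun setT k.
  apply/measurable_EFinP; apply: measurable_funM; last exact: mG'.
  by apply: mh => //; apply: measurable_funD => //; exact: measurable_funX.
have k0 z : (0 <= k z)%E by rewrite lee_fin mulr_ge0.
have kE v r s : 0 < r -> normsq3 v = r ^+ 2 ->
    h v (1 + s ^+ 2) * G (s / Num.sqrt (1 + s ^+ 2)) =
    r * zonal G (r * s) (normsq3 v + (r * s) ^+ 2).
  move=> r0 v_r.
  have -> : normsq3 v + (r * s) ^+ 2 = r ^+ 2 * (1 + s ^+ 2) by rewrite v_r; ring.
  rewrite /h /zonal v_r (sqrtrM (1 + s ^+ 2) (sqr_ge0 r)) sqrtr_sqr.
  rewrite gtr0_norm// -mulf_div.
  by rewrite divff ?gt_eqF// mul1r (mulrC (1 + _)) mulrA.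
apply: (etrans (integral_sfprod1 leb3 mu mf f0)).
transitivity (\int[leb3]_v \int[mu]_s k (v, s))%E.
  apply: ge0_ae_eq_integral => //.
  - exact: (measurable_fun_fubini_tonelli_F (m2 := mu) f mf f0).
  - exact: (measurable_fun_fubini_tonelli_F (m2 := mu) k mk k0).
  - by move=> v _; apply: integral_ge0.
  - by move=> v _; apply: integral_ge0.
  (* The inner integrals are compared only for [v != 0]. *)
  exists [set v | normsq3 v = 0]; split.
  - have := measurable_normsq3 measurableT
      (lebesgue_stieltjes_measure.measurable_set1 0).
    by rewrite setTI.
  - exact: normsq3_null.
  move=> v; apply: contra_notP => /eqP v0 _.
  set r := Num.sqrt (normsq3 v).
  have r0 : 0 < r by rewrite sqrtr_gt0 lt_neqAle eq_sym v0 normsq3_ge0.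
  have r2 : normsq3 v = r ^+ 2 by rewrite sqr_sqrtr ?normsq3_ge0.
  have mfv : measurable_fun setT (fun t => f (v, t)).
    exact: (measurableT_comp mf (pair1_measurable _)).
  have := (scales_mul_pos r0).2 _ mfv (fun=> f0 _).
  move=> /(congr1 (fun x => r%:E * x)%E).
  rewrite muleA -EFinM divff ?gt_eqF// mul1e => <-.
  rewrite -ge0_integralZl//; last 2 first.
  - exact: (measurableT_comp mfv (scales_mul_pos r0).1).
  - by rewrite lee_fin ltW.
  apply: eq_integral => s _; rewrite /f /k -EFinM; congr EFin.
  exact/esym/kE.
have fub := fubini_tonelli (m1 := leb3) (m2 := mu) k mk k0.
apply: (etrans fub) => {fub}.
have mw : measurable_fun setT (fun s : R =>
    (G (s / Num.sqrt (1 + s ^+ 2)) * (1 + s ^+ 2) ^- 2)%:E).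
  apply/measurable_EFinP; apply: measurable_funM; first exact: mG'.
  exact: measurable_weight.
have w0 (s : R) :
    (0 <= (G (s / Num.sqrt (1 + s ^+ 2)) * (1 + s ^+ 2) ^- 2)%:E)%E.
  by rewrite lee_fin mulr_ge0// invr_ge0 sqr_ge0.
rewrite -ge0_integralZl//; last exact: radial_mass_ge0.
apply: eq_integral => s _.
pose l : R := Num.sqrt (1 + s ^+ 2).
have s2 : 0 < 1 + s ^+ 2 by rewrite ltr_pwDl ?sqr_ge0.
have l0 : 0 < l by rewrite sqrtr_gt0.
have l2 : 1 + s ^+ 2 = l ^+ 2 by rewrite sqr_sqrtr// ltW.
have [_ sc] := scales_homothety l0.
pose H (v : R * R * R) := (Num.sqrt (normsq3 v) * ball_indic (normsq3 v))%:E.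
have mH : measurable_fun setT H.
  apply/measurable_EFinP; apply: measurable_funM.
    exact: measurable_sqrtr measurable_normsq3.
  exact: (measurableT_comp measurable_ball_indic measurable_normsq3).
have H0 v : (0 <= H v)%E by rewrite lee_fin mulr_ge0 ?sqrtr_ge0 ?ball_indic_ge0.
have {sc} := sc H mH H0.
pose phi (v : R * R * R) : R * R * R := (l * v.1.1, l * v.1.2, l * v.2).
rewrite -[LHS]/(\int[leb3]_v H (phi v))%E => sc.
have mHphi : measurable_fun setT (fun v => H (phi v)).
  exact: (measurableT_comp mH (scales_homothety l0).1).
(* [|v| = |phi v| / l] accounts for the division by [l]; the other three come from [sc]. *)
transitivity (\int[leb3]_v ((G (s / l) / l)%:E * H (phi v)))%E.
  apply: eq_integral => v _; rewrite /k /H -EFinM; congr EFin => /=.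
  have -> : normsq3 (phi v) = l ^+ 2 * normsq3 v by rewrite /normsq3 /=; ring.
  rewrite /h l2 (sqrtrM (normsq3 v) (sqr_ge0 l)) sqrtr_sqr gtr0_norm// -/l.
  by field; rewrite gt_eqF.
rewrite ge0_integralZl//; last by rewrite lee_fin divr_ge0 ?G0// ltW.
rewrite sc muleA -EFinM muleC; congr (_ * _%:E)%E.
by rewrite -/l l2; field; rewrite gt_eqF.
Qed.

End polar.

(** * Integrals over the line *)

Section one_dimensional_integrals.
Context {R : realType}.
Local Notation mu := (@lebesgue_measure R).

Lemma is_derive1_cvg (F : R -> R) (x d : R) :
  is_derive x (1 : R) F d -> F y @[y --> x] --> F x.
Proof. by move=> [/derivable1_diffP/differentiable_continuous]. Qed.

Lemma FTC2_is_derive (f F : R -> R) (a b : R) : a < b ->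
  (forall x, a <= x <= b -> {for x, continuous f}) ->
  (forall x, a <= x <= b -> is_derive x (1 : R) F (f x)) ->
  (\int[mu]_(x in `[a, b]) (f x)%:E = (F b)%:E - (F a)%:E)%E.
Proof.
move=> ab cf dF; apply: continuous_FTC2 => //.
- apply: continuous_in_subspaceT => x /set_mem/=; rewrite in_itv/= => xab.
  exact: cf.
- split.
  + move=> x; rewrite in_itv/= => /andP[/ltW ax /ltW xb].
    by have [] := dF x _; rewrite ?ax ?xb.
  + by apply: cvg_at_right_filter; apply: is_derive1_cvg (dF a _); rewrite lexx ltW.
  + by apply: cvg_at_left_filter; apply: is_derive1_cvg (dF b _); rewrite lexx ltW.
- move=> x; rewrite in_itv/= => /andP[/ltW ax /ltW xb].
  by rewrite derive1E; have [] := dF x _; rewrite ?ax ?xb.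
Qed.

Lemma integral_even_is_derive (f F : R -> R) (l : R) :
  (forall x, 0 <= f x) -> continuous f -> (forall x, f (- x) = f x) ->
  (forall x, is_derive x (1 : R) F (f x)) -> F 0 = 0 ->
  F x @[x --> +oo] --> l ->
  (\int[mu]_x (f x)%:E = (2 * l)%:E)%E.
Proof.
move=> f0 cf fN dF F0 Fl.
rewrite ge0_symfun_integralT//; last by move=> x /=; rewrite fN.
rewrite -set_itvcy (@ge0_continuous_FTC2y _ f F 0 l)//.
- by rewrite F0 sube0 -EFinM.
- exact: continuous_subspaceT.
- by apply: cvg_at_right_filter; apply: is_derive1_cvg (dF 0).
- by move=> x _; rewrite derive1E; have [] := dF x.
Qed.

Lemma oneDsqr_gt0 (x : R) : 0 < 1 + x ^+ 2.
Proof. by rewrite ltr_pwDl ?sqr_ge0. Qed.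

Lemma oneDsqr_neq0 (x : R) : 1 + x ^+ 2 != 0.
Proof. by rewrite gt_eqF ?oneDsqr_gt0. Qed.

Lemma cvgy_oneDsqr_ratio : x / (1 + x ^+ 2) @[x --> +oo] --> (0 : R).
Proof.
apply: (@squeeze_cvgr _ _ _ _ (fun=> 0) (fun x : R => x^-1)).
- near=> x; have x0 : 0 < x by near: x; exact: nbhs_pinfty_gt.
  have x0' := ltW x0.
  apply/andP; split; first by rewrite divr_ge0 ?addr_ge0 ?sqr_ge0.
  rewrite -subr_ge0 (_ : _ - _ = x^-1 / (1 + x ^+ 2)); last first.
    by field; rewrite (gt_eqF x0) oneDsqr_neq0.
  by rewrite divr_ge0 ?invr_ge0 ?addr_ge0 ?sqr_ge0.
- exact: cvg_cst.
- by apply/(gtr0_cvgV0 (f := id)) => //; exact: nbhs_pinfty_gt.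
Unshelve. all: by end_near. Qed.

Lemma is_derive_oneDsqrV (a s : R) : is_derive s (1 : R)
  (fun s => (1 + (a * s) ^+ 2)^-1) (- 2 * a ^+ 2 * s / (1 + (a * s) ^+ 2) ^+ 2).
Proof.
have h : is_derive s (1 : R) (fun s => 1 + (a * s) ^+ 2) (2 * a ^+ 2 * s).
  by apply: is_derive_eq; rewrite /GRing.scale/=; ring.
have D := @is_deriveV _ (fun s => 1 + (a * s) ^+ 2) s _ 1
  (oneDsqr_neq0 (a * s)) h.
apply: (is_derive_eq D); rewrite /GRing.scale/=.
by field; exact: oneDsqr_neq0.
Qed.

Lemma is_derive_weight1 (s : R) : is_derive s (1 : R)
  (fun s => (1 + s ^+ 2)^-1) (- 2 * s / (1 + s ^+ 2) ^+ 2).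
Proof.
have := is_derive_oneDsqrV 1 s.
rewrite (_ : (fun _ => _) = fun s => (1 + s ^+ 2)^-1); last first.
  by apply/funext => x; rewrite mul1r.
by rewrite mul1r expr1n mulr1.
Qed.

Lemma continuous_weight : continuous (fun s : R => (1 + s ^+ 2) ^- 2).
Proof.
move=> s; rewrite (_ : (fun _ => _) = (fun s => (1 + s ^+ 2)^-1 ^+ 2)).
  have D := is_derive_weight1 s.
  by apply: is_derive1_cvg; apply: is_derive_eq.
by apply/funext => x; rewrite exprVn.
Qed.

(** Used twice: as the normalizing integral, with the profile 1, and for the [ln 2] term in
    [integral_log_profile]. *)
Lemma integral_weight : (\int[mu]_s ((1 + s ^+ 2) ^- 2)%:E = (pi / 2)%:E)%E.
Proof.
pose F (s : R) := 2^-1 * (s * (1 + s ^+ 2)^-1 + atan s).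
have dF s : is_derive s (1 : R) F ((1 + s ^+ 2) ^- 2).
  have D := is_derive_weight1 s.
  apply: is_derive_eq; rewrite /GRing.scale/=.
  by field; exact: oneDsqr_neq0.
have Fl : F x @[x --> +oo] --> 2^-1 * (0 + pi / 2).
  apply: cvgMl_tmp; apply: cvgD; first exact: cvgy_oneDsqr_ratio.
  exact: cvgy_atan.
rewrite (integral_even_is_derive _ continuous_weight _ dF _ Fl).
- by congr EFin; field.
- by move=> s; rewrite invr_ge0 sqr_ge0.
- by move=> s; rewrite sqrrN.
- by rewrite /F mul0r atan0 add0r mulr0.
Qed.

(* Partial fractions in [s ^ 2]. *)
Lemma integral_partial_fraction (a : R) : 0 < a < 1 ->
  (\int[mu]_s (s ^+ 2 / ((1 + (a * s) ^+ 2) * (1 + s ^+ 2) ^+ 2))%:E =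
   (pi / 2 / (1 + a) ^+ 2)%:E)%E.
Proof.
move=> /andP[a0 a1].
have b0 : 1 - a != 0 by rewrite subr_eq0 gt_eqF.
have c0 : 1 + a != 0 by rewrite gt_eqF// addr_gt0.
(* With [q = s^2] the integrand is [be / (1 + q) - a^2 be / (1 + a^2 q) - ga / (1 + q)^2]; [F]
   integrates it term by term. *)
pose be := ((1 - a) * (1 + a)) ^- 2.
pose ga := ((1 - a) * (1 + a))^-1.
pose f (s : R) := s ^+ 2 * (1 + (a * s) ^+ 2)^-1 * (1 + s ^+ 2)^-1 ^+ 2.
pose F (s : R) := be * (atan s - a * atan (a * s)) -
  ga / 2 * (s * (1 + s ^+ 2)^-1 + atan s).
have dF s : is_derive s (1 : R) F (f s).
  have D := is_derive_weight1 s.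
  apply: is_derive_eq; rewrite /GRing.scale/= /f /be /ga.
  by field; rewrite !oneDsqr_neq0 b0 c0.
have Fl : F x @[x --> +oo] -->
    be * (pi / 2 - a * (pi / 2)) - ga / 2 * (0 + pi / 2).
  apply: cvgB; apply: cvgMl_tmp.
    apply: cvgB; first exact: cvgy_atan.
    apply: cvgMl_tmp.
    apply: (@cvg_comp _ _ _ (fun s : R => a * s) atan _ _ _ _ (@cvgy_atan R)).
    by apply: gt0_cvgMry => //; exact: cvg_id.
  by apply: cvgD; [exact: cvgy_oneDsqr_ratio|exact: cvgy_atan].
have cf : continuous f.
  move=> s; have D1 := is_derive_weight1 s; have D2 := is_derive_oneDsqrV a s.
  by rewrite /f; apply: is_derive1_cvg; apply: is_derive_eq.
transitivity (\int[mu]_s (f s)%:E)%E.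
  by apply: eq_integral => s _; rewrite /f invfM exprVn mulrA.
rewrite (integral_even_is_derive _ cf _ dF _ Fl).
- by congr EFin; rewrite /be /ga; field; apply/andP.
- move=> s; apply: mulr_ge0; last exact: sqr_ge0.
  by apply: mulr_ge0; rewrite ?sqr_ge0// invr_ge0 ltW ?oneDsqr_gt0.
- by move=> s; rewrite /f mulrN !sqrrN.
- by rewrite /F !(mulr0, mul0r, atan0, subr0, addr0, subrr).
Qed.

End one_dimensional_integrals.

(** * The logarithmic integral, by differentiation in a parameter *)

Section log_integrals.
Context {R : realType}.
Local Notation mu := (@lebesgue_measure R).

Lemma integral_indicM (D : set R) (h : R -> R) :
  (\int[mu]_a (\1_D a * h a)%:E = \int[mu]_(a in D) (h a)%:E)%E.
Proof.
rewrite [RHS]integral_mkcond; apply: eq_integral => a _.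
by rewrite patchE indicE; case: (a \in D); rewrite ?mul1r ?mul0r.
Qed.

(** The interval is open because [integral_partial_fraction] covers only [0 < a < 1]: its
    coefficients have a pole at [a = 1]. *)
Lemma FTC2_is_derive_oo (f F : R -> R) (a b : R) : a < b ->
  (forall x, a <= x <= b -> {for x, continuous f}) ->
  (forall x, a <= x <= b -> is_derive x (1 : R) F (f x)) ->
  (\int[mu]_(x in `]a, b[) (f x)%:E = (F b - F a)%:E)%E.
Proof.
move=> ab cf dF; rewrite EFinB -(FTC2_is_derive ab cf dF).
apply/esym/integral_itv_bndoo; apply/measurable_EFinP.
apply: open_continuous_measurable_fun => // x /set_mem/=.
by rewrite in_itv/= => /andP[ax xb]; apply: cf; rewrite !ltW.
Qed.

Lemma is_derive1_ln_comp (g : R -> R) (x dg : R) : 0 < g x ->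
  is_derive x (1 : R) g dg -> is_derive x (1 : R) (fun y => ln (g y)) (dg / g x).
Proof.
move=> g0 D; have := is_derive1_comp (is_derive1_ln g0) D.
by rewrite mulrC.
Qed.

(** What is left of the double integral once [s] is integrated out. The primitive comes from [a / (1
    + a)^2 = 1 / (1 + a) - 1 / (1 + a)^2]. *)
Lemma integral_ratio01 :
  (\int[mu]_(a in `]0%R, 1%R[) (pi * (a / (1 + a) ^+ 2))%:E =
   (pi * ln 2 - pi / 2 : R)%:E)%E.
Proof.
have pos (x : R) : 0 <= x <= 1 -> 0 < 1 + x by move=> /andP[? _]; rewrite ltr_pwDl.
have D1 (x : R) : is_derive x (1 : R) (fun y : R => 1 + y) 1.
  by apply: is_derive_eq; rewrite add0r mulr1.
have DV (x : R) : 0 <= x <= 1 ->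
    is_derive x (1 : R) (fun y : R => (1 + y)^-1) (- (1 + x) ^- 2).
  move=> /pos x0; have x1 : 1 + x != 0 by rewrite gt_eqF.
  have D := @is_deriveV _ (fun y => 1 + y) x _ 1 x1 (D1 x).
  by apply: (is_derive_eq D); rewrite /GRing.scale/= mulr1.
pose F (a : R) := pi * (ln (1 + a) + (1 + a)^-1).
have dF (x : R) : 0 <= x <= 1 -> is_derive x (1 : R) F (pi * (x / (1 + x) ^+ 2)).
  move=> x01; have D := DV x x01; have x0 := pos x x01.
  have DL := is_derive1_ln_comp x0 (D1 x).
  apply: is_derive_eq; rewrite /GRing.scale/=.
  by field; rewrite gt_eqF.
have cf (x : R) : 0 <= x <= 1 ->
    {for x, continuous (fun a : R => pi * (a / (1 + a) ^+ 2) : R)}.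
  move=> x01; have D := DV x x01.
  rewrite (_ : (fun _ => _) = (fun a => pi * (a * (1 + a)^-1 ^+ 2))).
    by apply: is_derive1_cvg; apply: is_derive_eq.
  by apply/funext => y; rewrite exprVn.
rewrite (FTC2_is_derive_oo ltr01 cf dF); congr EFin.
by rewrite /F addr0 ln1 invr1 (_ : 1 + 1 = 2 :> R)//; field.
Qed.

(* The [a]-derivative of [ln (1 + (a s)^2) / (1 + s^2)^2], so that integrating in
   [s] first involves only rational functions. *)
Definition log_kernel (s a : R) : R :=
  2 * a * (s ^+ 2 / ((1 + (a * s) ^+ 2) * (1 + s ^+ 2) ^+ 2)).

Lemma integral_log_kernel (s : R) :
  (\int[mu]_(a in `]0%R, 1%R[) (log_kernel s a)%:E =
   (ln (1 + s ^+ 2) * (1 + s ^+ 2) ^- 2)%:E)%E.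
Proof.
pose g (a : R) := 1 + (a * s) ^+ 2.
have Dg (x : R) : is_derive x (1 : R) g (2 * x * s ^+ 2).
  by apply: is_derive_eq; rewrite /GRing.scale/=; ring.
pose F (a : R) := ln (g a) * (1 + s ^+ 2) ^- 2.
have dF (a : R) : 0 <= a <= 1 -> is_derive a (1 : R) F (log_kernel s a).
  move=> _; have DL := is_derive1_ln_comp (g := g) (oneDsqr_gt0 (a * s)) (Dg a).
  apply: is_derive_eq; rewrite /GRing.scale/= /log_kernel /g.
  by field; rewrite !oneDsqr_neq0.
have cf (a : R) : 0 <= a <= 1 -> {for a, continuous (log_kernel s)}.
  move=> _; have DV := @is_deriveV _ g a _ 1 (oneDsqr_neq0 (a * s)) (Dg a).
  rewrite (_ : log_kernel s =
      (fun a => 2 * a * (s ^+ 2 * ((g a)^-1 * (1 + s ^+ 2) ^- 2)))).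
    by apply: is_derive1_cvg; apply: is_derive_eq.
  by apply/funext => y; rewrite /log_kernel invfM.
rewrite (FTC2_is_derive_oo ltr01 cf dF); congr EFin.
by rewrite /F /g mul0r expr0n/= addr0 ln1 mul0r subr0 mul1r.
Qed.

Lemma measurable_partial_fraction d (T : measurableType d) (f g : T -> R) :
  measurable_fun setT f -> measurable_fun setT g ->
  measurable_fun setT (fun x =>
    f x ^+ 2 / ((1 + (g x * f x) ^+ 2) * (1 + f x ^+ 2) ^+ 2)).
Proof.
move=> mf mg.
rewrite (_ : (fun _ => _) = (fun x => f x ^+ 2 *
    ((Num.sqrt (1 + (g x * f x) ^+ 2))^-1 ^+ 2 * (1 + f x ^+ 2) ^- 2))).
  apply: measurable_funM; first exact: measurable_funX.
  apply: measurable_funM; last exact: measurable_weight.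
  apply: measurable_funX; apply: measurable_sqrtrV; apply: measurable_funD => //.
  by apply: measurable_funX; exact: measurable_funM.
apply/funext => x; congr (_ * _); rewrite invfM; congr (_ * _).
by rewrite exprVn sqr_sqrtr// ltW ?oneDsqr_gt0.
Qed.

Lemma partial_fraction_ge0 (a s : R) :
  0 <= s ^+ 2 / ((1 + (a * s) ^+ 2) * (1 + s ^+ 2) ^+ 2).
Proof.
apply: divr_ge0; first exact: sqr_ge0.
by apply: mulr_ge0; [exact/ltW/oneDsqr_gt0|exact: sqr_ge0].
Qed.

Lemma integral_log_weight :
  (\int[mu]_s (ln (1 + s ^+ 2) * (1 + s ^+ 2) ^- 2)%:E =
   (pi * ln 2 - pi / 2 : R)%:E)%E.
Proof.
pose D : set R := `]0, 1[%classic.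
(* The indicator extends the range of [a] to the whole line, so that Tonelli applies on the
   plane. *)
pose k (z : R * R) : \bar R := (\1_D z.2 * log_kernel z.1 z.2)%:E.
have k0 z : (0 <= k z)%E.
  rewrite lee_fin indicE; have [/set_mem/=|_] := boolP (z.2 \in D); last first.
    by rewrite mul0r.
  rewrite /D/= in_itv/= => /andP[z0 _]; rewrite mul1r.
  have z0' := ltW z0.
  apply: mulr_ge0; first by rewrite mulr_ge0.
  exact: partial_fraction_ge0.
have mk : measurable_fun setT k.
  apply/measurable_EFinP; apply: measurable_funM.
    apply: (@measurableT_comp _ _ _ _ _ _ (\1_D : R -> R)) => //.
    by apply: measurable_indic; exact: measurable_itv.
  apply: measurable_funM; first exact: measurable_funM.
  exact: measurable_partial_fraction.
transitivity (\int[mu]_s \int[mu]_a k (s, a))%E.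
  apply: eq_integral => s _.
  rewrite -[RHS]/(\int[mu]_a (\1_D a * log_kernel s a)%:E)%E integral_indicM.
  exact/esym/integral_log_kernel.
have fub := fubini_tonelli (m1 := mu) (m2 := mu) k mk k0.
apply: (etrans fub) => {fub}.
rewrite -integral_ratio01 -/D -integral_indicM.
apply: eq_integral => a _.
rewrite /k /=.
rewrite indicE; have [/set_mem/= aD|_] := boolP (a \in D); last first.
  by rewrite mul0r; apply: integral0_eq => s _; rewrite mul0r.
transitivity (\int[mu]_s ((2 * (a : R))%:E *
  (s ^+ 2 / ((1 + (a * s) ^+ 2) * (1 + s ^+ 2) ^+ 2))%:E))%E.
  by apply: eq_integral => s _; rewrite mul1r.
move: aD; rewrite /D/= in_itv/= => aD; have /andP[/ltW a0 _] := aD.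
rewrite ge0_integralZl//; last 3 first.
- by apply/measurable_EFinP; apply: measurable_partial_fraction.
- by move=> s _; rewrite lee_fin partial_fraction_ge0.
- by rewrite lee_fin mulr_ge0.
rewrite integral_partial_fraction// -EFinM mul1r; congr EFin; field.
by rewrite gt_eqF// ltr_pwDl.
Qed.

End log_integrals.

(** * The logarithmic profile and its weighted integral *)

Section log_profile.
Context {R : realType}.
Local Notation mu := (@lebesgue_measure R).

(* [log (2 / |x - y|)] for unit vectors [x], [y] with [<x, y> = t]; it is nonnegative
   there, and the absolute value makes it so for every [t]. *)
Definition log_profile (t : R) : R := `|ln 2 - ln (2 - 2 * t) / 2|.

Lemma measurable_log_profile : measurable_fun setT log_profile.
Proof.
apply: (measurableT_comp (@normr_measurable R setT)).
apply: measurable_funB => //; apply: measurable_funM => //.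
by apply: (measurableT_comp (@measurable_ln R)); apply: measurable_funB.
Qed.

Lemma log_profile_ge0 t : 0 <= log_profile t.
Proof. exact: normr_ge0. Qed.

(** Here [2 - 2 t <= 4], so its logarithm is at most [2 ln 2]. At [t = 1] the default [ln 0 = 0]
    leaves [ln 2], still nonnegative. *)
Lemma log_profileE t : - 1 <= t <= 1 ->
  log_profile t = ln 2 - ln (2 - 2 * t) / 2.
Proof.
move=> /andP[t1 t1']; rewrite /log_profile ger0_norm// subr_ge0.
have ln2 : 0 <= ln 2 :> R by apply: ln_ge0; rewrite ler1n.
have [t_lt|t_ge] := ltP t 1; last first.
  have -> : 2 - 2 * t = 0 by lra.
  by rewrite ln0// mul0r.
rewrite ler_pdivrMr// mulr_natr -lnXn//.
rewrite ler_ln ?posrE ?exprn_gt0//; [|lra]; rewrite expr2; lra.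
Qed.

(** With [t = s / sqrt (1 + s^2)], the product [(2 - 2 t) (2 + 2 t)] is
    [4 (1 - t^2) = 4 / (1 + s^2)]. *)
Lemma log_profile_sym s :
  log_profile (s / Num.sqrt (1 + s ^+ 2)) +
  log_profile (- s / Num.sqrt (1 + s ^+ 2)) = ln 2 + ln (1 + s ^+ 2) / 2.
Proof.
set t := s / _.
have t2 : 1 - t ^+ 2 = (1 + s ^+ 2)^-1.
  rewrite /t expr_div_n sqr_sqrtr ?(ltW (oneDsqr_gt0 _))//.
  by field; rewrite oneDsqr_neq0.
have t_lt1 : `|t| < 1.
  rewrite -(@ltr_pXn2r _ 2) ?nnegrE// expr1n real_normK ?num_real//.
  by rewrite -subr_gt0 t2 invr_gt0 oneDsqr_gt0.
move: (t_lt1); rewrite ltr_norml => /andP[t1 t1'].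
rewrite mulNr -/t !log_profileE; [|lra..].
have -> : ln (1 + s ^+ 2) = - ln (1 - t ^+ 2)
  by rewrite t2 lnV ?posrE ?oneDsqr_gt0// opprK.
have -> : ln (1 - t ^+ 2) = ln (2 - 2 * t) + ln (2 - 2 * - t) - (ln 2 + ln 2).
  rewrite -!lnM ?posrE//; [|lra..].
  rewrite -ln_div ?posrE//; last by rewrite mulr_gt0; lra.
  by congr ln; field.
by field.
Qed.

Lemma integral_log_profile :
  (\int[mu]_s (log_profile (s / Num.sqrt (1 + s ^+ 2)) * (1 + s ^+ 2) ^- 2)%:E =
   (pi / 2 * (ln 2 - 1 / 4))%:E)%E.
Proof.
pose f (s : R) : \bar R :=
  (log_profile (s / Num.sqrt (1 + s ^+ 2)) * (1 + s ^+ 2) ^- 2)%:E.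
have f0 s : (0 <= f s)%E.
  by rewrite lee_fin mulr_ge0 ?log_profile_ge0// invr_ge0 sqr_ge0.
have mid : measurable_fun setT (fun s : R => s) by exact: measurable_id.
have mN : measurable_fun setT (fun s : R => - s) by exact: oppr_measurable.
have mf : measurable_fun setT f.
  apply/measurable_EFinP; apply: measurable_funM; last exact: measurable_weight.
  apply: (measurableT_comp measurable_log_profile); apply: measurable_funM => //.
  apply: measurable_sqrtrV; apply: measurable_funD => //; exact: measurable_funX.
have mfN : measurable_fun setT (fun s : R => f (- s)).
  exact: (measurableT_comp mf mN).
have fN := (@scales_opp R).2 f mf f0; rewrite mul1e in fN.
(* Doubling the integral and replacing [s] by [- s] in one copy gives
   [ln 2 * pi / 2 + (pi ln 2 - pi / 2) / 2]. *)
have ff : (\int[mu]_s f s + \int[mu]_s f s = (pi * (ln 2 - 1 / 4))%:E)%E.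
  rewrite -[in X in (_ + X)%E]fN -ge0_integralD//.
  transitivity (\int[mu]_s ((ln 2)%:E * ((1 + s ^+ 2) ^- 2)%:E +
      (2^-1)%:E * (ln (1 + s ^+ 2) * (1 + s ^+ 2) ^- 2)%:E))%E.
    apply: eq_integral => s _; rewrite /f -!EFinM -!EFinD sqrrN -mulrDl.
    by rewrite log_profile_sym; congr EFin; ring.
  have ln2 : 0 <= ln 2 :> R by apply: ln_ge0; rewrite ler1n.
  have w0 (s : R) : 0 <= (1 + s ^+ 2) ^- 2 by rewrite invr_ge0 sqr_ge0.
  have l0 (s : R) : 0 <= ln (1 + s ^+ 2) by rewrite ln_ge0// lerDl sqr_ge0.
  have mw : measurable_fun setT (fun s : R => ((1 + s ^+ 2) ^- 2)%:E).
    by apply/measurable_EFinP; exact: measurable_weight.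
  have ml : measurable_fun setT
      (fun s : R => (ln (1 + s ^+ 2) * (1 + s ^+ 2) ^- 2)%:E).
    apply/measurable_EFinP; apply: measurable_funM; last exact: measurable_weight.
    apply: (measurableT_comp (@measurable_ln R)); exact: measurable_funD.
  rewrite ge0_integralD//; last 4 first.
  - by move=> s _; rewrite -EFinM lee_fin mulr_ge0.
  - exact: measurable_funeM.
  - by move=> s _; rewrite -EFinM lee_fin !mulr_ge0.
  - exact: measurable_funeM.
  rewrite !ge0_integralZl//; do ?[by move=> s _; rewrite lee_fin ?mulr_ge0].
  by rewrite integral_weight integral_log_weight -!EFinM -EFinD; congr EFin; field.
(* Halving is legitimate only for a finite value; an infinite one would contradict [ff]. *)
move: ff; rewrite -/f; case: (\int[mu]_s f s)%E => // r [rr].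
by congr EFin; lra.
Qed.

End log_profile.

(** * The unit sphere *)

Section sphere_coordinates.
Context {R : realType}.
Local Notation mu := (@lebesgue_measure R).

Definition coords4 (x : 4.-tuple R) : R * R * R * R :=
  (tnth x (@Ordinal 4 0 isT), tnth x (@Ordinal 4 1 isT),
   tnth x (@Ordinal 4 2 isT), tnth x (@Ordinal 4 3 isT)).

Definition scale4 (t : R) (z : R * R * R * R) : R * R * R * R :=
  (t * z.1.1.1, t * z.1.1.2, t * z.1.2, t * z.2).

Lemma tuple4_of_pairK : cancel (@tuple4_of_pair R) coords4.
Proof. by case=> [[[a b] c] d]. Qed.

Lemma coords4K : cancel coords4 (@tuple4_of_pair R).
Proof.
move=> x; apply: eq_from_tnth => i.
by case: i => [[|[|[|[|//]]]] i4]; rewrite (tnth_nth 0) /=; congr (tnth x _);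
  apply: val_inj.
Qed.

Lemma enormE (x : 4.-tuple R) : enorm x = Num.sqrt (dot4 (coords4 x) (coords4 x)).
Proof.
rewrite /enorm !big_ord_recl big_ord0 addr0 /dot4 /coords4 /= -!expr2 !addrA.
congr (Num.sqrt (tnth x _ ^+ 2 + tnth x _ ^+ 2 + tnth x _ ^+ 2 + tnth x _ ^+ 2));
  exact: val_inj.
Qed.

Lemma dot4_ge0 (z : R * R * R * R) : 0 <= dot4 z z.
Proof. by rewrite /dot4 -!expr2 !addr_ge0 ?sqr_ge0. Qed.

Lemma sphere3E (x : 4.-tuple R) : sphere3 x <-> dot4 (coords4 x) (coords4 x) = 1.
Proof.
rewrite /sphere3 /= enormE; split=> [h|->]; last exact: sqrtr1.
by rewrite -[LHS]sqr_sqrtr ?dot4_ge0// h expr1n.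
Qed.

Lemma dot4_scale t z : dot4 (scale4 t z) (scale4 t z) = t ^+ 2 * dot4 z z.
Proof. by rewrite /dot4 /=; ring. Qed.

Lemma dot4_scaler t x z : dot4 x (scale4 t z) = t * dot4 x z.
Proof. by rewrite /dot4 /=; ring. Qed.

Lemma scale4_tuple t (y : 4.-tuple R) :
  [tuple t * tnth y i | i < 4] = tuple4_of_pair (scale4 t (coords4 y)).
Proof.
apply: (can_inj coords4K); rewrite tuple4_of_pairK /coords4 /scale4 /=.
by rewrite !tnth_mktuple.
Qed.

Lemma edist_sphere3 (x y : 4.-tuple R) : sphere3 x -> sphere3 y ->
  Defs.edist x y = Num.sqrt (2 - 2 * dot4 (coords4 x) (coords4 y)).
Proof.
move=> /sphere3E hx /sphere3E hy; rewrite /Defs.edist enormE; congr Num.sqrt.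
have -> : 2 - 2 * dot4 (coords4 x) (coords4 y) =
  dot4 (coords4 x) (coords4 x) + dot4 (coords4 y) (coords4 y) -
  2 * dot4 (coords4 x) (coords4 y) by rewrite hx hy.
by rewrite /dot4 /coords4 /= !tnth_mktuple; ring.
Qed.

(** Expand [|x - y|^2 >= 0] and [|x + y|^2 >= 0]. *)
Lemma dot4_sphere3 (x y : 4.-tuple R) : sphere3 x -> sphere3 y ->
  -1 <= dot4 (coords4 x) (coords4 y) <= 1.
Proof.
move=> /sphere3E; case: (coords4 x) => [[[a b] c] d].
move=> + /sphere3E; case: (coords4 y) => [[[p q] r] s]; rewrite /dot4 /= => hx hy.
have := addr_ge0 (addr_ge0 (sqr_ge0 (a - p)) (sqr_ge0 (b - q)))
  (addr_ge0 (sqr_ge0 (c - r)) (sqr_ge0 (d - s))).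
have := addr_ge0 (addr_ge0 (sqr_ge0 (a + p)) (sqr_ge0 (b + q)))
  (addr_ge0 (sqr_ge0 (c + r)) (sqr_ge0 (d + s))).
rewrite !sqrrD !sqrrN => h1 h2; apply/andP; split; lra.
Qed.

(** Shifting by [ln 2] replaces a signed integrand by a nonnegative one, to which Tonelli applies.
    For [x = y] both sides are 0, by [ln 0 = 0] and [1 / 0 = 0]. *)
Lemma ln_edistE (x y : 4.-tuple R) : sphere3 x -> sphere3 y ->
  ln (1 / Defs.edist x y) = log_profile (dot4 (coords4 x) (coords4 y)) - ln 2.
Proof.
move=> sx sy; have xy := dot4_sphere3 sx sy.
rewrite edist_sphere3// log_profileE// mul1r (addrC (ln 2)) addrK.
set u := 2 - 2 * _; have : 0 <= u by move/andP: xy => [_]; rewrite /u; lra.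
rewrite le_eqVlt => /predU1P[<-|u0].
  by rewrite sqrtr0 invr0 ln0// mul0r oppr0.
have su : 0 < Num.sqrt u by rewrite sqrtr_gt0.
rewrite lnV ?posrE//; congr (- _).
by rewrite -[in RHS](sqr_sqrtr (ltW u0)) lnXn//
  -[X in X / 2]mulr_natr mulfK ?pnatr_eq0.
Qed.

(* Radial projection of the punctured unit ball onto the sphere; the rest of the
   space is sent to the origin, off the sphere. *)
Definition ball_proj (z : R * R * R * R) : 4.-tuple R :=
  tuple4_of_pair (scale4 (ball_indic (dot4 z z) / Num.sqrt (dot4 z z)) z).

Lemma sphere3_ball_proj z : sphere3 (ball_proj z) <-> 0 < dot4 z z <= 1.
Proof.
apply: (iff_trans (sphere3E _)).
rewrite /ball_proj tuple4_of_pairK dot4_scale ball_indicE; split.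
  by have [//|_] := boolP (0 < dot4 z z <= 1); rewrite mul0r expr0n/= mul0r =>
    /esym/eqP; rewrite oner_eq0.
move=> z01; rewrite z01 expr_div_n expr1n sqr_sqrtr ?dot4_ge0// mul1r mulVf//.
by case/andP: z01 => /gt_eqF ->.
Qed.

(** Turns the cones defining surface measure into preimages under [ball_proj], so that surface
    measure becomes 4 times a pushforward of Lebesgue measure. *)
Lemma preimage_unit_cone (A : set (4.-tuple R)) :
  @tuple4_of_pair R @^-1` unit_cone (A `&` @sphere3 R) =
  ball_proj @^-1` (A `&` @sphere3 R).
Proof.
apply/seteqP; split=> [z [t [y [Ay sy] [/andP[t0 t1] zty]]]|z [Az sz]].
  have zE : z = scale4 t (coords4 y).
    by rewrite -[LHS]tuple4_of_pairK zty scale4_tuple tuple4_of_pairK.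
  have zz : dot4 z z = t ^+ 2.
    by rewrite zE dot4_scale (sphere3E y).1// mulr1.
  suff : ball_proj z = y by rewrite /preimage /= => ->.
  rewrite /ball_proj zz ball_indicE exprn_gt0// expr_le1 ?(ltW t0)// t1 mul1r.
  rewrite sqrtr_sqr gtr0_norm// -[RHS]coords4K zE; congr tuple4_of_pair.
  case: (coords4 y) => [[[a b] c] d]; rewrite /scale4 /=.
  by rewrite !mulKf ?gt_eqF.
have /sphere3_ball_proj/andP[z0 z1] := sz.
(* The height of [z] in the cone is its norm, and its base point is its projection. *)
exists (Num.sqrt (dot4 z z)); exists (ball_proj z) => //; split.
  by rewrite sqrtr_gt0 z0 -sqrtr1 ler_wsqrtr.
rewrite scale4_tuple tuple4_of_pairK ball_indicE z0 z1 mul1r.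
case: z {Az sz} z0 z1 => [[[a b] c] d] z0 z1; congr tuple4_of_pair.
by rewrite /scale4 /= !mulVKf// gt_eqF ?sqrtr_gt0.
Qed.

Lemma measurable_coords :
  [/\ measurable_fun setT (fun z : R * R * R * R => z.1.1.1),
  measurable_fun setT (fun z : R * R * R * R => z.1.1.2),
  measurable_fun setT (fun z : R * R * R * R => z.1.2) &
  measurable_fun setT (fun z : R * R * R * R => z.2)].
Proof.
split => //; last exact: measurableT_comp.
all: by apply: measurableT_comp => //; exact: measurableT_comp.
Qed.

Lemma measurable_dot4 d (T : measurableType d) (f g : T -> R * R * R * R) :
  measurable_fun setT f -> measurable_fun setT g ->
  measurable_fun setT (fun t => dot4 (f t) (g t)).
Proof.
have [m1 m2 m3 m4] := measurable_coords => mf mg.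
by do ![apply: measurable_funD|apply: measurable_funM];
 [exact: (measurableT_comp m1)|exact: (measurableT_comp m1)
 |exact: (measurableT_comp m2)|exact: (measurableT_comp m2)
 |exact: (measurableT_comp m3)|exact: (measurableT_comp m3)
 |exact: (measurableT_comp m4)|exact: (measurableT_comp m4)].
Qed.

Lemma measurable_tuple4_of_pair : measurable_fun setT (@tuple4_of_pair R).
Proof.
have [m1 m2 m3 m4] := measurable_coords.
by apply/measurable_fun_tnthP => -[[|[|[|[|//]]]] i4].
Qed.

Lemma measurable_coords4 : measurable_fun setT coords4.
Proof.
by do 3 (apply: measurable_fun_pair; last exact: measurable_tnth);
  exact: measurable_tnth.
Qed.

Lemma measurable_ball_proj : measurable_fun setT ball_proj.
Proof.
have md := measurable_dot4 (@measurable_id _ _ setT) (@measurable_id _ _ setT).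
have mk : measurable_fun setT (fun z : R * R * R * R =>
    ball_indic (dot4 z z) / Num.sqrt (dot4 z z)).
  apply: measurable_funM; last exact: measurable_sqrtrV md.
  exact: (measurableT_comp measurable_ball_indic md).
have [m1 m2 m3 m4] := measurable_coords.
apply: (measurableT_comp measurable_tuple4_of_pair).
by do 3 (apply: measurable_fun_pair; last exact: measurable_funM);
  exact: measurable_funM.
Qed.

Lemma measurable_sphere3 : measurable (@sphere3 R).
Proof.
have md := measurable_dot4 measurable_coords4 measurable_coords4.
have := md measurableT _ (lebesgue_stieltjes_measure.measurable_set1 1).
by rewrite setTI; congr measurable; apply/seteqP; split=> x /sphere3E.
Qed.

End sphere_coordinates.

(** * The uniform law as a pushforward from the unit ball *)

Section uniform_law.
Context {R : realType} d (T : measurableType d) (P : probability T R).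
Local Notation mu := (@lebesgue_measure R).

Lemma lebesgue4_unit_cone (A : set (4.-tuple R)) :
  lebesgue4 (unit_cone (A `&` @sphere3 R)) =
  pushforward (@leb4 R) ball_proj (A `&` @sphere3 R).
Proof. by rewrite /lebesgue4 /pushforward preimage_unit_cone. Qed.

(** The constant is 4 over the total surface [b]. That [b] is positive and finite is read off the
    hypothesis: the law has mass [b / b = 1], whereas this quotient is 0 when [b] is 0 or
    infinite. *)
Lemma uniform_distributionE (X : {RV P >-> 4.-tuple R}) : uniform_on_sphere3 X ->
  exists c : {nonneg R}, forall A, measurable A ->
    distribution P X A =
    (c%:num%:E * pushforward (@leb4 R) ball_proj (A `&` @sphere3 R))%E.
Proof.
move=> [_ unifX].
have sE A : surface_measure A =
    (4%:R%:E * pushforward (@leb4 R) ball_proj (A `&` @sphere3 R))%E.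
  by rewrite /surface_measure lebesgue4_unit_cone.
pose b := surface_measure (@sphere3 R).
have b0 : (0 <= b)%E by rewrite /b sE /pushforward mule_ge0 ?lee_fin.
have bb : (b / b)%E = 1%E.
  have sT : surface_measure setT = b by rewrite /b !sE setTI setIid.
  transitivity (normalized_surface_measure (@setT (4.-tuple R))).
    by rewrite /normalized_surface_measure sT.
  by apply: (etrans (esym (unifX _ measurableT))); exact: probability_setT.
have [r br r0] : exists2 r, b = r%:E & 0 < r.
  move: b0 bb; case: b => [r| |//].
  - rewrite lee_fin le_eqVlt => /predU1P[<-|r0 _]; last by exists r.
    by rewrite mul0e => /esym/eqP; rewrite onee_eq0.
  - by rewrite invey mule0 => _ /esym/eqP; rewrite onee_eq0.
have c0 : 0 <= 4 / r by rewrite divr_ge0// ltW.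
exists (NngNum c0) => A mA; rewrite (unifX _ mA) /normalized_surface_measure -/b br.
by rewrite inver gt_eqF// sE muleAC -EFinM.
Qed.

Lemma uniform_integralE (X : {RV P >-> 4.-tuple R}) : uniform_on_sphere3 X ->
  exists2 c : R, 0 <= c & forall h : 4.-tuple R -> \bar R,
    measurable_fun setT h -> (forall y, (0 <= h y)%E) ->
    (\int[distribution P X]_y h y =
     c%:E * \int[leb4]_(z in ball_proj @^-1` @sphere3 R) h (ball_proj z))%E.
Proof.
move=> unifX; have [c distE] := uniform_distributionE unifX.
exists c%:num => // h mh h0.
have mS := @measurable_sphere3 R.
have mhS : measurable_fun (@sphere3 R) h by apply: measurable_funTS.
(* Since [X] lies on the sphere, the integral may be restricted to it; on subsets of the sphere the
   intersection in [distE] disappears. *)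
transitivity (\int[distribution P X]_(y in @sphere3 R) h y)%E.
  have := @ge0_integral_pushforward _ _ _ _ _ _ (@measurable_funPT _ _ _ _ X)
    P _ h mS mhS (fun y _ => h0 y).
  have -> : X @^-1` @sphere3 R = setT.
    by apply/seteqP; split=> // w _; apply: unifX.1.
  rewrite -/(distribution P X) => ->.
  by rewrite ge0_integral_distribution.
pose nu := pushforward (@leb4 R) (@ball_proj R).
have E A : measurable A -> A `<=` @sphere3 R ->
    distribution P X A = mscale c nu A.
  by move=> mA /setIidPl AS; rewrite (distE _ mA) AS.
rewrite (eq_measure_integral _ (E (@measurable_ball_proj R))).
rewrite ge0_integral_mscale//; congr (_ * _)%E.
rewrite ge0_integral_pushforward//.
exact: measurable_ball_proj.
Qed.

End uniform_law.

(** * Expectations *)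

Section expected_log_distance.
Context {R : realType} d (T : measurableType d) (P : probability T R).
Local Notation mu := (@lebesgue_measure R).

(** The constant [M] is chosen before [G] and [x], so it can be identified by testing with
    [G = 1]. *)
Lemma uniform_zonal (X : {RV P >-> 4.-tuple R}) : uniform_on_sphere3 X ->
  exists M : \bar R, forall (G : R -> R) (x : 4.-tuple R), sphere3 x ->
    measurable_fun setT G -> (forall t, 0 <= G t) ->
    (\int[distribution P X]_y (G (dot4 (coords4 x) (coords4 y)))%:E =
     M * \int[mu]_s (G (s / Num.sqrt (1 + s ^+ 2)) * (1 + s ^+ 2) ^- 2)%:E)%E.
Proof.
move=> unifX; have [c c0 distE] := uniform_integralE unifX.
exists (c%:E * @radial_mass R)%E => G x sx mG G0.
have md := measurable_dot4 (measurable_cst (coords4 x)) (@measurable_coords4 R).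
rewrite distE; last 2 first.
- by apply/measurable_EFinP; exact: (measurableT_comp mG md).
- by move=> y; rewrite lee_fin.
rewrite -muleA; congr (_ * _)%E.
rewrite -integral_zonal// integral_mkcond.
pose f (z : R * R * R * R) := (zonal G (dot4 (coords4 x) z) (dot4 z z))%:E.
have mf : measurable_fun setT f.
  apply/measurable_EFinP; apply: measurable_zonal => //.
  - exact: measurable_dot4.
  - exact: measurable_dot4.
have f0 z : (0 <= f z)%E by rewrite lee_fin zonal_ge0.
transitivity (\int[leb4]_z f z)%E.
  apply: eq_integral => z _; rewrite patchE /f /zonal ball_indicE.
  case: ifPn => [/set_mem/sphere3_ball_proj z01|zS].
    rewrite /ball_proj tuple4_of_pairK dot4_scaler ball_indicE z01.
    by rewrite !mul1r mulrC.
  rewrite (_ : (_ && _) = false) ?mul0r//; apply/negbTE; apply: contraNN zS.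
  by move=> z01; apply/mem_set; exact: (sphere3_ball_proj z).2.
(* An isometry moves [x] to the last axis, where [integral_zonal] applies. *)
have : isotropic (coords4 x).
  move/sphere3E: sx; case: (coords4 x) => [[[a b] c'] d'].
  by rewrite /dot4 /= -!expr2; exact: isotropicP.
move=> [phi [[_ sphi] phiE]].
have := sphi f mf f0; rewrite mul1e => <-.
by apply: eq_integral => z _; rewrite /f; have [-> ->] := phiE z.
Qed.

Lemma uniform_log_profile (X : {RV P >-> 4.-tuple R}) (x : 4.-tuple R) :
  uniform_on_sphere3 X -> sphere3 x ->
  (\int[distribution P X]_y (log_profile (dot4 (coords4 x) (coords4 y)))%:E =
   (ln 2 - 1 / 4)%:E)%E.
Proof.
move=> unifX sx; have [M ME] := uniform_zonal unifX.
(* The profile 1 integrates to the total mass 1, which determines [M]. *)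
have M1 : (M * (pi / 2)%:E = 1)%E.
  have total : (\int[distribution P X]_y 1%:E = 1)%E.
    by rewrite integral_cst// mul1e; exact: probability_setT.
  rewrite -[RHS]total (ME (fun=> 1) x sx (measurable_cst _) (fun=> ler01)).
  congr (_ * _)%E; rewrite -integral_weight; apply: eq_integral => s _.
  by rewrite mul1r.
rewrite ME//; [|exact: measurable_log_profile|exact: log_profile_ge0].
by rewrite integral_log_profile EFinM muleA M1 mul1e.
Qed.

(** The joint law and the product of the laws agree on rectangles, hence everywhere; Tonelli then
    integrates [Y] out first. *)
Lemma independent_integral d1 d2 (T1 : measurableType d1) (T2 : measurableType d2)
    (X : {RV P >-> T1}) (Y : {RV P >-> T2}) :
  (forall A B, measurable A -> measurable B ->
    P (X @^-1` A `&` Y @^-1` B) = P (X @^-1` A) * P (Y @^-1` B))%E ->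
  forall g : T1 * T2 -> \bar R,
  measurable_fun setT g -> (forall z, 0 <= g z)%E ->
  (\int[P]_w g (X w, Y w) =
   \int[P]_w \int[distribution P Y]_y g (X w, y))%E.
Proof.
move=> XY g mg g0.
have mXY : measurable_fun setT (fun w => (X w, Y w)) by exact: measurable_fun_pair.
have E A : measurable A ->
    (distribution P X \x distribution P Y)%E A =
    pushforward P (fun w => (X w, Y w)) A.
  by apply: product_measure_unique => A1 A2 m1 m2; rewrite -XY.
have push := ge0_integral_pushforward mXY P measurableT mg (fun y _ => g0 y).
rewrite preimage_setT in push; apply: (etrans (esym push)) => {push}.
apply: (etrans (eq_measure_integral (distribution P X \x distribution P Y)%E _)).
  by move=> A mA _; exact/esym/E.
apply: (etrans (fubini_tonelli1 (m1 := distribution P X)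
  (m2 := distribution P Y) g mg g0)).
apply: ge0_integral_distribution.
- exact: measurable_fun_fubini_tonelli_F.
- by move=> x; apply: integral_ge0.
Qed.

Lemma mutually_independent_pair d' (T' : measurableType d') (I : finType)
    (p : I -> {RV P >-> T'}) i j :
  mutually_independent p -> i != j ->
  forall A B, measurable A -> measurable B ->
    (P (p i @^-1` A `&` p j @^-1` B) = P (p i @^-1` A) * P (p j @^-1` B))%E.
Proof.
move=> indep ij A B mA mB.
(* Only the values at [i] and [j] matter for the index set [{i, j}], so [B] may stand everywhere
   else. *)
pose C k := if k == i then A else B.
have mC k : measurable (C k) by rewrite /C; case: ifP.
have := indep [set i; j]%SET C mC.
rewrite big_setU1 ?inE// big_set1 /C eqxx eq_sym (negbTE ij) => <-.
congr (P _); apply/seteqP; split=> w /=.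
  move=> [Aw Bw] k; rewrite /= !inE => /orP[/eqP ->|/eqP ->]; first by rewrite eqxx.
  by rewrite eq_sym (negbTE ij).
move=> ABw; split.
  by have := ABw i; rewrite /= !inE eqxx; apply.
by have := ABw j; rewrite /= !inE eqxx orbT eq_sym (negbTE ij); apply.
Qed.

End expected_log_distance.

(** * Mean energy of one pair, then of all pairs by linearity *)

Section expected_energy.
Context {R : realType} d (T : measurableType d) (P : probability T R).

(** Integrability comes with the value: the shifted integrand is nonnegative with finite integral
    [ln 2 - 1 / 4], and the constant [ln 2] is then subtracted. *)
Lemma integral_log_distance (X Y : {RV P >-> 4.-tuple R}) :
  uniform_on_sphere3 X -> uniform_on_sphere3 Y ->
  (forall A B, measurable A -> measurable B ->
    P (X @^-1` A `&` Y @^-1` B) = P (X @^-1` A) * P (Y @^-1` B))%E ->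
  P.-integrable setT (fun w => (ln (1 / Defs.edist (X w) (Y w)))%:E) /\
  (\int[P]_w (ln (1 / Defs.edist (X w) (Y w)))%:E = (- (1 / 4))%:E)%E.
Proof.
move=> unifX unifY indep.
pose g (z : 4.-tuple R * 4.-tuple R) : \bar R :=
  (log_profile (dot4 (coords4 z.1) (coords4 z.2)))%:E.
have mg : measurable_fun setT g.
  apply/measurable_EFinP; apply: (measurableT_comp measurable_log_profile).
  by apply: measurable_dot4; apply: (measurableT_comp measurable_coords4).
have g0 z : (0 <= g z)%E by rewrite lee_fin log_profile_ge0.
have intg : (\int[P]_w g (X w, Y w) = (ln 2 - 1 / 4)%:E)%E.
  rewrite (independent_integral indep mg g0).
  under eq_integral => w _ do rewrite /g (uniform_log_profile unifY (unifX.1 w)).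
  by rewrite integral_cst//= probability_setT mule1.
have mgXY : measurable_fun setT (fun w => g (X w, Y w)).
  by apply: (measurableT_comp mg); exact: measurable_fun_pair.
have igXY : P.-integrable setT (fun w => g (X w, Y w)).
  apply/integrableP; split=> //.
  under eq_integral => w _ do rewrite gee0_abs//.
  by rewrite intg ltry.
have icst : P.-integrable setT (fun=> (ln 2)%:E)
  by exact: finite_measure_integrable_cst.
have -> : (fun w => (ln (1 / Defs.edist (X w) (Y w)))%:E) =
    (fun w => g (X w, Y w) - (ln 2)%:E)%E.
  by apply/funext => w; rewrite ln_edistE ?EFinB//;
    [exact: unifX.1|exact: unifY.1].
split; first exact: integrableB.
rewrite integralB// intg integral_cst//= probability_setT mule1 -EFinB.
by congr EFin; ring.
Qed.

End expected_energy.

Theorem lemma2p1 (R : realType) (d : measure_display) (T : measurableType d)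
    (P : probability T R) (N : nat) (p : 'I_N -> {RV P >-> 4.-tuple R})
    (p_unif : forall i : 'I_N, uniform_on_sphere3 (p i))
    (p_indep : mutually_independent p) :
  ('E_P[fun w => log_energy (fun i => p i w)] =
    (- (1 / 4) * N%:R ^+ 2 + 1 / 4 * N%:R)%R%:E)%E.
Proof.
pose f i j w := (ln (1 / Defs.edist (p i w) (p j w)))%:E.
have fP i j : i != j ->
    P.-integrable setT (f i j) /\ (\int[P]_w f i j w = (- (1 / 4))%:E)%E.
  by move=> ij; apply: integral_log_distance => //; exact: mutually_independent_pair.
(* Padding the diagonal with 0 makes both sums run over all indices. *)
pose h i j w := if i != j then f i j w else 0%E.
have ih i j : P.-integrable setT (h i j).
  by rewrite /h; case: (boolP (i != j)) => [/fP[]|_] //; exact: integrable0.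
have -> : 'E_P[fun w => log_energy (fun i => p i w)]%E =
    (\int[P]_w \sum_(i < N) \sum_(j < N) h i j w)%E.
  rewrite unlock; apply: eq_integral => w _.
  rewrite /log_energy -sumEFin; apply: eq_bigr => i _.
  by rewrite -sumEFin big_mkcond.
rewrite integral_sum//; last by move=> i; exact: integrable_sum.
under eq_bigr => i _.
  rewrite integral_sum//.
  have -> : (\sum_(j < N) \int[P]_w h i j w = (- (1 / 4) * (N%:R - 1))%:E)%E.
    rewrite (bigD1 i)//= {1}/h eqxx/= integral0 add0e.
    rewrite (eq_bigr (fun=> (- (1 / 4))%:E)); last first.
      by move=> j ji; rewrite /h eq_sym ji; apply: (fP _ _ _).2; rewrite eq_sym.
    rewrite sumEFin sumr_const; congr EFin.
    (* The truncated predecessor [N.-1] is a true [N - 1], because the index [i] forces [N > 0]. *)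
    rewrite cardC1 card_ord (_ : N%:R - 1 = N.-1%:R) ?mulr_natr//.
    by rewrite -[in LHS](prednK (leq_ltn_trans (leq0n i) (ltn_ord i))) -natr1 addrK.
  over.
rewrite sumEFin sumr_const card_ord -mulr_natr; congr EFin.
by ring.
Qed.
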